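(* Let $C$ be a simple point--line configuration in the plane $\mathbb{R}^2$. Then the sign pattern associated with $C$ has minimum rank $2$ if and only if the following three conditions hold: (i) $C$ contains at least $2$ points and at least $2$ lines; (ii) each point of $C$ lies on at most one line of $C$, and each line of $C$ passes through at most one point of $C$; and (iii) $C$ is equivalent to a simple point--line configuration $C_1$ all of whose lines are parallel to each other.
   Context: A sign pattern is a matrix with entries in $\{+,-,0\}$; for a real matrix $B$, $\operatorname{sgn}(B)$ replaces positive/negative/zero entries by $+,-,0$; $Q(\mathcal{A})=\{A\text{ real}:\operatorname{sgn}(A)=\mathcal{A}\}$; the minimum rank $\operatorname{mr}(\mathcal{A})$ is the minimum rank of a matrix in $Q(\mathcal{A})$. An $m$ point--$n$ line configuration $C$ in $\mathbb{R}^2$ consists of labeled points $p_1,\dots,p_m$ and labeled lines $l_1,\dots,l_n$. Each line is oriented: non-vertical lines point to the right (increasing $x$), vertical lines point upward. The sign pattern associated with $C$ is the $m\times n$ sign pattern $\mathcal{A}=[a_{ij}]$ with $a_{ij}=+$ if $p_i$ lies to the left of $l_j$ (i.e., above $l_j$ when $l_j$ is non-vertical), $a_{ij}=-$ if $p_i$ lies to the right of $l_j$ (below, when non-vertical), and $a_{ij}=0$ if $p_i$ lies on $l_j$. Two sign patterns $\mathcal{A}_1,\mathcal{A}_2$ are equivalent if $\mathcal{A}_2=P_1D_1\mathcal{A}_1D_2P_2$ for some permutation sign patterns $P_1,P_2$ (a square sign pattern with exactly one $+$ in each row and column and all other entries $0$) and signature sign patterns $D_1,D_2$ (square diagonal sign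 patterns with all diagonal entries nonzero). Two point--line configurations are equivalent if their associated sign patterns are equivalent. A point--line configuration $C$ is simple if: no two points of $C$ have identical or exactly opposite positions (above/below/on) relative to all lines of $C$; no two lines of $C$ have identical or exactly opposite positions relative to all points of $C$; no point of $C$ lies on all lines of $C$; and no line of $C$ passes through all points of $C$. *)

(* Defs.v *)
From HB Require Import structures.
From mathcomp Require Import all_boot all_order all_algebra.
From mathcomp Require Import boolp reals.

Set Implicit Arguments.
Unset Strict Implicit.
Unset Printing Implicit Defensive.
Import Order.TTheory GRing.Theory Num.Theory.
Local Open Scope ring_scope.

(* The signs +, -, 0 are the integers 1, -1, 0. *)
Definition is_sign : {pred int} := [pred x | x \in [:: 1; -1; 0]].

Record sign_pattern (m n : nat) := SignPattern {
  sp_mx :> 'M[int]_(m, n);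
  sp_mxP : sp_mx \is a mxOver is_sign }.

HB.instance Definition _ m n := [isSub for @sp_mx m n].

Fact sgn_subproof (R : realType) (m n : nat) (B : 'M[R]_(m, n)) :
  map_mx (@sgz R) B \is a mxOver is_sign.
Proof. by apply/mxOverP => i j; rewrite mxE; case: sgzP. Qed.

Definition sgn (R : realType) (m n : nat) (B : 'M[R]_(m, n)) :
  sign_pattern m n := SignPattern (sgn_subproof B).

Definition qual_class (R : realType) (m n : nat) (A : sign_pattern m n)
  (B : 'M[R]_(m, n)) : Prop := sgn B = A.

Definition rank_attained (R : realType) (m n : nat) (A : sign_pattern m n)
  : pred nat :=
  fun r => `[< exists B : 'M[R]_(m, n), qual_class A B /\ \rank B = r >].

Fact rank_attained_nonempty (R : realType) (m n : nat) (A : sign_pattern m n) :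
  exists r, rank_attained R A r.
Proof.
pose B : 'M[R]_(m, n) := map_mx intr (sp_mx A).
exists (\rank B); apply/asboolP; exists B; split=> //.
apply: val_inj; apply/matrixP => i j; rewrite !mxE.
have /mxOverP/(_ i j) := sp_mxP A.
rewrite !inE => /or3P[] /eqP ->; first by rewrite sgz1.
- by rewrite mulrN1z sgzN sgz1.
- by rewrite sgz0.
Qed.

Definition min_rank (R : realType) (m n : nat) (A : sign_pattern m n) : nat :=
  ex_minn (rank_attained_nonempty R A).

Definition permutation_pattern (n : nat) (P : sign_pattern n n) : Prop :=
  is_perm_mx (sp_mx P).

Definition signature_pattern (n : nat) (D : sign_pattern n n) : Prop :=
  is_diag_mx (sp_mx D) /\ forall i, D i i != 0.

(* Every entry of the product below has at most one nonzero summand, so the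
   integer matrix product is the product of sign patterns. *)
Definition sp_equiv (m n : nat) (A1 A2 : sign_pattern m n) : Prop :=
  exists (P1 D1 : sign_pattern m m) (D2 P2 : sign_pattern n n),
    [/\ permutation_pattern P1, signature_pattern D1,
        signature_pattern D2, permutation_pattern P2
      & sp_mx A2 = P1 *m D1 *m A1 *m D2 *m P2].

(* [NonVertical a b] is the line y = a x + b, [Vertical c] is the line x = c;
   every line of the plane has exactly one such representation. *)
Variant line (R : realType) :=
  | NonVertical (slope intercept : R)
  | Vertical (abscissa : R).

Definition on_line (R : realType) (l : line R) (p : R * R) : bool :=
  match l with
  | NonVertical a b => p.2 == a * p.1 + b
  | Vertical c => p.1 == c
  end.

(* Non-vertical lines point to the right and vertical lines point upward. *)
Definition left_of (R : realType) (l : line R) (p : R * R) : bool :=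
  match l with
  | NonVertical a b => a * p.1 + b < p.2
  | Vertical c => p.1 < c
  end.

Definition parallel (R : realType) (l1 l2 : line R) : Prop :=
  match l1, l2 with
  | NonVertical a1 _, NonVertical a2 _ => a1 = a2
  | Vertical _, Vertical _ => True
  | _, _ => False
  end.

Definition position (R : realType) (p : R * R) (l : line R) : int :=
  if on_line l p then 0 else if left_of l p then 1 else -1.

Record configuration (R : realType) (m n : nat) := Configuration {
  point : 'I_m -> R * R;
  cline : 'I_n -> line R }.

Definition pattern_mx (R : realType) (m n : nat) (C : configuration R m n) :
  'M[int]_(m, n) := \matrix_(i, j) position (point C i) (cline C j).

Fact pattern_subproof (R : realType) (m n : nat) (C : configuration R m n) :
  pattern_mx C \is a mxOver is_sign.
Proof.
by apply/mxOverP => i j; rewrite mxE /position; case: ifP => // _; case: ifP.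
Qed.

Definition pattern (R : realType) (m n : nat) (C : configuration R m n) :
  sign_pattern m n := SignPattern (pattern_subproof C).

Definition conf_equiv (R : realType) (m n : nat) (C1 C2 : configuration R m n)
  : Prop := sp_equiv (pattern C1) (pattern C2).

Definition simple_conf (R : realType) (m n : nat) (C : configuration R m n)
  : Prop :=
  [/\ forall i1 i2, i1 != i2 ->
        ~ (forall j, position (point C i1) (cline C j)
                   = position (point C i2) (cline C j)) /\
        ~ (forall j, position (point C i1) (cline C j)
                   = - position (point C i2) (cline C j)),
      forall j1 j2, j1 != j2 ->
        ~ (forall i, position (point C i) (cline C j1)
                   = position (point C i) (cline C j2)) /\
        ~ (forall i, position (point C i) (cline C j1)
                   = - position (point C i) (cline C j2)),
      forall i, ~ (forall j, on_line (cline C j) (point C i))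
    & forall j, ~ (forall i, on_line (cline C j) (point C i))].

(* Main.v *)
Require Import Defs.
From mathcomp Require Import all_boot all_order all_algebra.
From mathcomp Require Import boolp reals.
From mathcomp Require Import all_fingroup ring.

(* Along a family of parallel lines the position of a point is the sign of a
   difference [s_i - t_j], and a matrix of such differences has rank at most 2.
   Conversely, a rank 2 matrix in the qualitative class of the pattern has
   entries [<u_i, v_j>] with [u_i], [v_j] nonzero vectors of the plane; in
   generic coordinates [u_i = d_i (s_i, 1)] and [v_j = e_j (1, - t_j)], so the
   entries are [d_i e_j (s_i - t_j)] and the pattern is, up to signatures, that
   of the points [(0, s_i)] and the lines [y = t_j].  Simplicity makes any two
   rows linearly independent, so the rank is at least 2; if it is 2, any two
   rows span all of them, and a column vanishing on both would vanish.  The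
   same holds for the columns. *)

Set Implicit Arguments.
Unset Strict Implicit.
Unset Printing Implicit Defensive.
Import Order.TTheory GRing.Theory Num.Theory.
Local Open Scope ring_scope.

Section PairwiseFreeRows.
Context (F : fieldType) (m n : nat).

Definition pairwise_free_rows (B : 'M[F]_(m, n)) : Prop :=
  (forall i, row i B != 0) /\
  (forall i1 i2, (row i1 B <= row i2 B)%MS -> i1 = i2).

Lemma pairwise_free_rows_rank_gt1 (B : 'M[F]_(m, n)) :
  pairwise_free_rows B -> (1 < m)%N -> (1 < \rank B)%N.
Proof.
move=> [rowB_neq0 rowB_inj] m_gt1; rewrite ltnNge; apply/negP => rankB.
pose i1 := Ordinal (ltnW m_gt1); pose i2 := Ordinal m_gt1.
suff /(congr1 val) : i1 = i2 by [].
apply/rowB_inj/(submx_trans (row_sub i1 B)).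
by rewrite -(geq_leqif (mxrank_leqif_sup (row_sub i2 B))) rank_rV rowB_neq0.
Qed.

Lemma rank_le2_sub_rows (B : 'M[F]_(m, n)) i1 i2 :
  (\rank B <= 2)%N -> row i2 B != 0 -> ~~ (row i1 B <= row i2 B)%MS ->
  (B <= row i1 B + row i2 B)%MS.
Proof.
move=> rankB row2_neq0 row1_free.
have sub_B : (row i1 B + row i2 B <= B)%MS by rewrite addsmx_sub !row_sub.
rewrite -(geq_leqif (mxrank_leqif_sup sub_B)).
have : (row i2 B < row i1 B + row i2 B)%MS.
  by rewrite ltmxE addsmxSr addsmx_sub submx_refl andbT.
rewrite ltmxErank rank_rV row2_neq0 => /andP[_].
exact: leq_trans rankB.
Qed.

Lemma pairwise_free_rows_zero_inj (B : 'M[F]_(m, n)) j i1 i2 :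
  pairwise_free_rows B -> (\rank B <= 2)%N -> row j B^T != 0 ->
  B i1 j = 0 -> B i2 j = 0 -> i1 = i2.
Proof.
move=> [rowB_neq0 rowB_inj] rankB.
rewrite -tr_col trmx_eq0 => colB_neq0 B1_eq0 B2_eq0.
apply: rowB_inj; apply: contra_neqT colB_neq0 => row1_free.
rewrite colE; apply/sub_kermxP.
apply: submx_trans (rank_le2_sub_rows rankB (rowB_neq0 i2) row1_free) _.
rewrite addsmx_sub; apply/andP.
by split; apply/sub_kermxP; rewrite -colE; apply/rowP => k; rewrite !mxE.
Qed.

End PairwiseFreeRows.

Section DifferenceMatrices.
Context (F : fieldType) (m n : nat).

Definition diff_mx (s : 'I_m -> F) (t : 'I_n -> F) : 'M[F]_(m, n) :=
  \matrix_(i, j) (s i - t j).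

Definition rescale_mx (d : 'I_m -> F) (e : 'I_n -> F) (B : 'M[F]_(m, n)) :
  'M[F]_(m, n) := \matrix_(i, j) (d i * e j * B i j).

Lemma rank_diff_mx s t : (\rank (diff_mx s t) <= 2)%N.
Proof.
have -> : diff_mx s t = (\col_i s i) *m const_mx 1 - const_mx 1 *m (\row_j t j).
  by apply/matrixP => i j; rewrite !mxE !big_ord1 !mxE mulr1 mul1r.
rewrite -mulmxN; apply: leq_trans (mxrank_add _ _) _.
apply: (@leq_add _ _ 1 1).
- exact: leq_trans (mxrankM_maxl _ _) (rank_leq_col _).
- exact: leq_trans (mxrankM_maxl _ _) (rank_leq_col _).
Qed.

Lemma rank_rescale_mx d e B : (\rank (rescale_mx d e B) <= \rank B)%N.
Proof.
have -> : rescale_mx d e B =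
    diag_mx (\row_i d i) *m (B *m diag_mx (\row_j e j)).
  apply/matrixP => i j; rewrite mul_diag_mx mul_mx_diag !mxE.
  by rewrite -mulrA [e j * _]mulrC.
exact: leq_trans (mxrankM_maxr _ _) (mxrankM_maxl _ _).
Qed.

End DifferenceMatrices.

Lemma rank_mxsub (F : fieldType) (m n p q : nat) (f : 'I_p -> 'I_m)
    (g : 'I_q -> 'I_n) (B : 'M[F]_(m, n)) :
  (\rank (mxsub f g B) <= \rank B)%N.
Proof.
rewrite mxsubrc; apply: leq_trans (mxrankS (rowsub_sub _ _)) _.
by rewrite -{1}[B]mulmx1 -mulmx_colsub mxrankM_maxl.
Qed.

Lemma rank_leq_factor (F : fieldType) (m n r : nat) (B : 'M[F]_(m, n)) :
  (\rank B <= r)%N ->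
  exists (U : 'M[F]_(m, r)) (V : 'M[F]_(n, r)), B = U *m V^T.
Proof.
move=> rankB.
exists (col_ebase B *m pid_mx (\rank B)), (pid_mx (\rank B) *m row_ebase B)^T.
rewrite trmxK -mulmxA [pid_mx _ *m (_ *m _)]mulmxA mul_pid_mx minnn.
by rewrite (minn_idPr rankB) mulmxA mulmx_ebase.
Qed.

Lemma rV2_neq0 (R : nmodType) (u : 'rV[R]_2) :
  u != 0 -> (u 0 0 != 0) || (u 0 1 != 0).
Proof.
apply: contra_neqT; rewrite negb_or !negbK => /andP[/eqP u0 /eqP u1].
apply/rowP => k; rewrite mxE.
by have /orP[/eqP->|/eqP->] : (k == 0) || (k == 1) by case: k => [[|[]]].
Qed.

Section GenericCoordinates.
Context (F : numFieldType).

Lemma exists_combination_neq0 (I : finType) (x y : I -> F) :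
  (forall i, (x i != 0) || (y i != 0)) ->
  exists c, forall i, c * x i + y i != 0.
Proof.
move=> xy_neq0; pose c := 1 + \sum_i `|y i / x i|.
have slope_lt i : `|y i / x i| < c.
  by rewrite ltr_pwDl // (bigD1 i) //= lerDl sumr_ge0.
exists c => i; apply/eqP => /eqP.
rewrite addrC addr_eq0 => /eqP y_eq.
have [x0|x_neq0] := eqVneq (x i) 0.
  by move: (xy_neq0 i); rewrite y_eq x0 mulr0 oppr0 eqxx.
have := slope_lt i; rewrite y_eq mulNr mulfK // normrN ger0_norm ?ltxx //.
exact: le_trans (normr_ge0 _) (ltW (slope_lt i)).
Qed.

(* The shear [(x, y) |-> (x, c x + y)] of the [u_i] and its inverse transpose
   applied to the [v_j] leave the products [<u_i, v_j>] unchanged. *)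
Lemma mulmx2_rescale_diff_mx (m n : nat) (U : 'M[F]_(m, 2)) (V : 'M[F]_(n, 2)) :
  (forall i, row i U != 0) -> (forall j, row j V != 0) ->
  exists (d s : 'I_m -> F) (e t : 'I_n -> F),
    [/\ forall i, d i != 0, forall j, e j != 0
      & U *m V^T = rescale_mx d e (diff_mx s t)].
Proof.
move=> rowU_neq0 rowV_neq0.
pose x k := match k with inl i => U i 0 | inr j => - V j 1 end.
pose y k := match k with inl i => U i 1 | inr j => V j 0 end.
have [|c cP] := @exists_combination_neq0 ('I_m + 'I_n)%type x y.
  case=> [i|j] /=; first by have := rV2_neq0 (rowU_neq0 i); rewrite !mxE.
  by rewrite oppr_eq0 orbC; have := rV2_neq0 (rowV_neq0 j); rewrite !mxE.
pose d i := c * U i 0 + U i 1; pose e j := c * - V j 1 + V j 0.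
have d_neq0 i : d i != 0 := cP (inl i).
have e_neq0 j : e j != 0 := cP (inr j).
exists d, (fun i => U i 0 / d i), e, (fun j => - (V j 1 / e j)); split=> //.
apply/matrixP => i j; rewrite !mxE !big_ord_recl big_ord0 !mxE addr0.
have -> : lift 0 0 = 1 :> 'I_2 by apply: val_inj.
rewrite /d /e; field; apply/andP.
by split; [apply: e_neq0 | apply: d_neq0].
Qed.

Lemma rank_le2_rescale_diff_mx (m n : nat) (B : 'M[F]_(m, n)) :
  (\rank B <= 2)%N -> (forall i, row i B != 0) -> (forall j, row j B^T != 0) ->
  exists (d s : 'I_m -> F) (e t : 'I_n -> F),
    [/\ forall i, d i != 0, forall j, e j != 0
      & B = rescale_mx d e (diff_mx s t)].
Proof.
move=> /rank_leq_factor[U [V ->]] rowB_neq0 colB_neq0.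
apply: mulmx2_rescale_diff_mx => [i|j].
- by apply: contraNneq (rowB_neq0 i) => row0; rewrite row_mul row0 mul0mx.
- apply: contraNneq (colB_neq0 j) => row0.
  by rewrite trmx_mul trmxK row_mul row0 mul0mx.
Qed.

End GenericCoordinates.

Lemma neq0_sgz (R : realDomainType) (x : R) :
  x != 0 -> sgz x = (-1) ^+ (x < 0)%R.
Proof. by rewrite sgz_def => ->. Qed.

Definition signed_perm_equiv (m n : nat) (A1 A2 : 'M[int]_(m, n)) : Prop :=
  exists (s : 'S_m) (t : 'S_n) (a : 'I_m -> bool) (b : 'I_n -> bool),
    forall i j, A2 i j = (-1) ^+ a i * (-1) ^+ b j * A1 (s i) (t j).

Lemma signed_perm_equiv_sym (m n : nat) (A1 A2 : 'M[int]_(m, n)) :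
  signed_perm_equiv A1 A2 -> signed_perm_equiv A2 A1.
Proof.
case=> s [t [a [b A2E]]].
exists s^-1%g, t^-1%g, (a \o s^-1%g), (b \o t^-1%g) => i j.
by rewrite A2E !permKV -mulrA -mulrA mulrCA !signrMK.
Qed.

Lemma signed_perm_equiv_tr (m n : nat) (A1 A2 : 'M[int]_(m, n)) :
  signed_perm_equiv A1 A2 -> signed_perm_equiv A1^T A2^T.
Proof.
case=> s [t [a [b A2E]]]; exists t, s, b, a => j i.
by rewrite !mxE A2E [_ ^+ b j * _]mulrC.
Qed.

Definition simple_rows (m n : nat) (A : 'M[int]_(m, n)) : Prop :=
  (forall i, row i A != 0) /\
  (forall i1 i2 (a : bool), row i1 A = (-1) ^+ a *: row i2 A -> i1 = i2).

Lemma simple_rowsP (m n : nat) (a : 'I_m -> 'I_n -> int) :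
  simple_rows (\matrix_(i, j) a i j) <->
  (forall i1 i2, i1 != i2 ->
     ~ (forall j, a i1 j = a i2 j) /\ ~ (forall j, a i1 j = - a i2 j)) /\
  (forall i, ~ (forall j, a i j = 0)).
Proof.
set A := matrix_of_fun _ _.
have row_eq0 i : row i A = 0 <-> forall j, a i j = 0.
  split=> [/rowP eqA j|eqA]; first by have := eqA j; rewrite !mxE.
  by apply/rowP => j; rewrite !mxE.
have row_eq i1 i2 c : row i1 A = (-1) ^+ c *: row i2 A <->
    forall j, a i1 j = (-1) ^+ c * a i2 j.
  split=> [/rowP eqA j|eqA]; first by have := eqA j; rewrite !mxE.
  by apply/rowP => j; rewrite !mxE.
split=> [[row_neq0 row_inj]|[row_neq row_neq0]]; split.
- move=> i1 i2 /eqP i12; split=> eq_a12; apply: i12.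
  + by apply: (row_inj _ _ false); apply/row_eq => j; rewrite mul1r.
  + by apply: (row_inj _ _ true); apply/row_eq => j; rewrite mulN1r.
- by move=> i /row_eq0/eqP; apply/negP.
- by move=> i; apply/eqP => /row_eq0; apply: row_neq0.
- move=> i1 i2 c /row_eq eq_a12; apply: contraTeq isT => /row_neq[neq opp].
  case: c eq_a12 => eq_a12; [case: opp | case: neq] => j; rewrite eq_a12.
  + by rewrite mulN1r.
  + by rewrite mul1r.
Qed.

Lemma simple_rows_sgz (R : realFieldType) (m n : nat) (B : 'M[R]_(m, n)) :
  simple_rows (map_mx (@sgz R) B) -> pairwise_free_rows B.
Proof.
move=> [row_neq0 row_inj].
have rowB_neq0 i : row i B != 0.
  apply: contraNneq (row_neq0 i) => rowB0; apply/eqP/rowP => j.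
  by have /rowP/(_ j) := rowB0; rewrite !mxE => ->; rewrite sgz0.
split=> // i1 i2 /sub_rVP[c row_eq].
have c_neq0 : c != 0.
  by apply: contraNneq (rowB_neq0 i1) => c0; rewrite row_eq c0 scale0r.
apply: (row_inj _ _ (c < 0)); apply/rowP => j.
by have /rowP/(_ j) := row_eq; rewrite !mxE => ->; rewrite sgzM neq0_sgz.
Qed.

Lemma simple_rows_equiv (m n : nat) (A1 A2 : 'M[int]_(m, n)) :
  signed_perm_equiv A1 A2 -> simple_rows A1 -> simple_rows A2.
Proof.
case/signed_perm_equiv_sym=> s [t [a [b A1E]]] [row_neq0 row_inj].
split=> [i|i1 i2 c row_eq].
- apply: contraNneq (row_neq0 (s^-1 i)%g) => row0; apply/eqP/rowP => j.
  by have /rowP/(_ (t j)) := row0; rewrite !mxE A1E permKV => ->; rewrite mulr0.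
- apply: (@perm_inj _ s^-1%g).
  apply: (row_inj _ _ (a (s^-1 i1)%g (+) a (s^-1 i2)%g (+) c)).
  apply/rowP => j; have /rowP/(_ (t j)) := row_eq.
  rewrite !mxE !A1E !permKV => ->.
  rewrite !signr_addb -!mulrA; congr (_ * _).
  by rewrite [RHS]mulrCA signrMK mulrCA.
Qed.

Lemma perm_mx_is_sign (n : nat) (s : 'S_n) : perm_mx s \is a mxOver is_sign.
Proof. by apply/mxOverP => i j; rewrite !mxE; case: eqP. Qed.

Lemma diag_mx_is_sign (n : nat) (a : 'I_n -> bool) :
  diag_mx (\row_i (-1) ^+ a i) \is a mxOver is_sign.
Proof. by apply/mxOverP => i j; rewrite !mxE; case: eqP; case: (a i). Qed.

Lemma signature_patternE (n : nat) (D : sign_pattern n n) i :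
  signature_pattern D -> D i i = (-1) ^+ (D i i < 0)%R.
Proof.
case=> _ /(_ i); have /mxOverP/(_ i i) := sp_mxP D.
by rewrite !inE => /or3P[]/eqP->.
Qed.

Lemma sp_equivP (m n : nat) (A1 A2 : sign_pattern m n) :
  sp_equiv A1 A2 <-> signed_perm_equiv A1 A2.
Proof.
have productE (s : 'S_m) (t : 'S_n) d e i j :
    (perm_mx s *m diag_mx d *m A1 *m diag_mx e *m perm_mx t^-1) i j
    = d 0 (s i) * e 0 (t j) * A1 (s i) (t j).
  rewrite -col_permE -!mulmxA -row_permE mxE.
  by rewrite mul_diag_mx mul_mx_diag !mxE; ring.
split=> [[P1 [D1 [D2 [P2 []]]]]|[s [t [a [b A2E]]]]].
  move=> /is_perm_mxP[s P1E] sigD1 sigD2 /is_perm_mxP[t P2E] A2E.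
  exists s, t^-1%g, (fun i => D1 (s i) (s i) < 0).
  exists (fun j => D2 (t^-1 j)%g (t^-1 j)%g < 0) => i j.
  have [/diag_mxP[d D1E] _] := sigD1; have [/diag_mxP[e D2E] _] := sigD2.
  rewrite -(signature_patternE _ sigD1) -(signature_patternE _ sigD2).
  by rewrite A2E P1E P2E -{1}[t]invgK D1E D2E productE !mxE !eqxx.
exists (SignPattern (perm_mx_is_sign s)).
exists (SignPattern (diag_mx_is_sign (a \o s^-1%g))).
exists (SignPattern (diag_mx_is_sign (b \o t^-1%g))).
exists (SignPattern (perm_mx_is_sign t^-1)).
split; try exact: perm_mx_is_perm.
- by split=> [|i]; rewrite /= ?diag_mx_is_diag // !mxE eqxx signr_eq0.
- by split=> [|i]; rewrite /= ?diag_mx_is_diag // !mxE eqxx signr_eq0.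
- by apply/matrixP => i j; rewrite A2E productE !mxE /= !permK.
Qed.

Section MinimumRank.
Context (R : realType) (m n : nat).
Implicit Types (A : sign_pattern m n) (B : 'M[R]_(m, n)).

Lemma qual_classP A B : qual_class A B <-> forall i j, sgz (B i j) = A i j.
Proof.
split=> [<- i j|sgzB]; first by rewrite mxE.
by apply: val_inj; apply/matrixP => i j; rewrite mxE sgzB.
Qed.

Lemma min_rank_attained A :
  exists2 B : 'M[R]_(m, n), qual_class A B & \rank B = min_rank R A.
Proof. by rewrite /min_rank; case: ex_minnP => r /asboolP[B []]; exists B. Qed.

Lemma min_rank_leq A B : qual_class A B -> (min_rank R A <= \rank B)%N.
Proof.
rewrite /min_rank => qualB; case: ex_minnP => r _ r_min.
by apply: r_min; apply/asboolP; exists B.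
Qed.

Lemma min_rank_equiv A1 A2 : sp_equiv A1 A2 -> min_rank R A1 = min_rank R A2.
Proof.
suff min_rank_mono A A' : sp_equiv A A' -> (min_rank R A' <= min_rank R A)%N.
  move=> eqA; apply/eqP; rewrite eqn_leq !min_rank_mono //.
  by apply/sp_equivP/signed_perm_equiv_sym/sp_equivP.
case/sp_equivP => s [t [a [b A2E]]].
have [B /qual_classP sgzB <-] := min_rank_attained A.
pose B' := rescale_mx (fun i => (-1) ^+ a i) (fun j => (-1) ^+ b j)
  (mxsub s t B).
have qualB' : qual_class A' B'.
  apply/qual_classP => i j; rewrite A2E !mxE !sgzM sgzB.
  by rewrite !sgzX !sgzN1.
apply: leq_trans (min_rank_leq qualB') _.
exact: leq_trans (rank_rescale_mx _ _ _) (rank_mxsub _ _ _).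
Qed.

Lemma sp_equiv_rescale_mx (d : 'I_m -> R) (e : 'I_n -> R) B :
  (forall i, d i != 0) -> (forall j, e j != 0) ->
  sp_equiv (sgn (rescale_mx d e B)) (sgn B).
Proof.
move=> d_neq0 e_neq0; apply/sp_equivP; apply: signed_perm_equiv_sym.
exists 1%g, 1%g, (fun i => d i < 0), (fun j => e j < 0) => i j.
by rewrite !mxE !perm1 !sgzM (neq0_sgz (d_neq0 i)) (neq0_sgz (e_neq0 j)).
Qed.

End MinimumRank.

Section Positions.
Context (R : realType).

Definition transverse (l : line R) (p : R * R) : R :=
  match l with
  | NonVertical a _ => p.2 - a * p.1
  | Vertical _ => - p.1
  end.

Definition offset (l : line R) : R :=
  match l with
  | NonVertical _ b => b
  | Vertical c => - c
  end.

Lemma positionE p l : position p l = sgz (transverse l p - offset l).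
Proof.
rewrite /position; case: l => [a b|c] /=.
- by rewrite -subr_eq0 -subr_gt0 opprD addrA; case: sgzP.
- by rewrite opprK addrC eq_sym -subr_eq0 -subr_gt0; case: sgzP.
Qed.

Lemma position_eq0 p (l : line R) : (position p l == 0) = on_line l p.
Proof. by rewrite /position; case: on_line => //; case: left_of. Qed.

Lemma parallel_transverse (l1 l2 : line R) :
  parallel l1 l2 -> transverse l1 = transverse l2.
Proof. by case: l1 l2 => [a1 b1|c1] [a2 b2|c2] //= ->. Qed.

End Positions.

Section Configurations.
Context (R : realType) (m n : nat).
Implicit Types (C : configuration R m n) (s : 'I_m -> R) (t : 'I_n -> R).

Definition horizontal_conf s t : configuration R m n :=
  Configuration (fun i => (0, s i)) (fun j => NonVertical 0 (t j)).

Lemma pattern_horizontal_conf s t :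
  pattern (horizontal_conf s t) = sgn (diff_mx s t).
Proof.
by apply: val_inj; apply/matrixP => i j; rewrite !mxE positionE /= mulr0 subr0.
Qed.

Lemma parallel_pattern C :
  (forall j1 j2, parallel (cline C j1) (cline C j2)) ->
  exists s t, pattern C = sgn (diff_mx s t).
Proof.
move=> parC.
exists (fun i => if [pick j : 'I_n] is Some j
                 then transverse (cline C j) (point C i) else 0).
exists (fun j => offset (cline C j)).
apply: val_inj; apply/matrixP => i j; rewrite !mxE positionE.
by case: pickP => [j0 _|/(_ j)] //; rewrite (parallel_transverse (parC j j0)).
Qed.

Lemma simple_confP C :
  simple_conf C <-> simple_rows (pattern C) /\ simple_rows (pattern C)^T.
Proof.
have -> : (pattern C)^T = \matrix_(j, i) position (point C i) (cline C j).
  by apply/matrixP => j i; rewrite !mxE.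
rewrite !simple_rowsP.
split=> [[rowC colC row0 col0]|[[rowC row0] [colC col0]]].
- split; split=> // k pos0; [apply: (row0 k) | apply: (col0 k)] => l.
  + by rewrite -position_eq0 pos0.
  + by rewrite -position_eq0 pos0.
- split=> // k on; [apply: (row0 k) | apply: (col0 k)] => l.
  + by apply/eqP; rewrite position_eq0.
  + by apply/eqP; rewrite position_eq0.
Qed.

Lemma simple_conf_equiv C C' :
  conf_equiv C C' -> simple_conf C -> simple_conf C'.
Proof.
move/sp_equivP => eqC /simple_confP[rowsC colsC]; apply/simple_confP; split.
- exact: simple_rows_equiv eqC rowsC.
- exact: simple_rows_equiv (signed_perm_equiv_tr eqC) colsC.
Qed.

Section QualitativeClass.
Context (C : configuration R m n) (B : 'M[R]_(m, n)).
Hypotheses (simpleC : simple_conf C) (qualB : qual_class (pattern C) B).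

Lemma qual_class_pairwise_free :
  pairwise_free_rows B /\ pairwise_free_rows B^T.
Proof.
case/simple_confP: simpleC; rewrite -qualB /= map_trmx => rowsB colsB.
by split; apply: simple_rows_sgz.
Qed.

Lemma on_line_qual_class i j : on_line (cline C j) (point C i) = (B i j == 0).
Proof.
rewrite -position_eq0 -[B i j == 0]sgz_eq0.
by move/qual_classP: qualB => ->; rewrite mxE.
Qed.

Lemma rank_le2_on_line_inj : (\rank B <= 2)%N ->
  (forall i j1 j2, on_line (cline C j1) (point C i) ->
     on_line (cline C j2) (point C i) -> j1 = j2) /\
  (forall j i1 i2, on_line (cline C j) (point C i1) ->
     on_line (cline C j) (point C i2) -> i1 = i2).
Proof.
move=> rankB; have [rowsB colsB] := qual_class_pairwise_free.
split=> [i j1 j2|j i1 i2];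
  rewrite !on_line_qual_class => /eqP B1_eq0 /eqP B2_eq0.
- apply: (pairwise_free_rows_zero_inj (j := i) colsB); rewrite ?mxE //.
  + by rewrite mxrank_tr.
  + by rewrite trmxK rowsB.1.
- exact: pairwise_free_rows_zero_inj rowsB rankB (colsB.1 j) B1_eq0 B2_eq0.
Qed.

Lemma rank_le2_equiv_horizontal_conf :
  (\rank B <= 2)%N -> exists s t, conf_equiv C (horizontal_conf s t).
Proof.
move=> rankB; have [rowsB colsB] := qual_class_pairwise_free.
have [d [s [e [t [d_neq0 e_neq0 BE]]]]] :=
  rank_le2_rescale_diff_mx rankB rowsB.1 colsB.1.
exists s, t; rewrite /conf_equiv pattern_horizontal_conf -qualB BE.
exact: sp_equiv_rescale_mx.
Qed.

End QualitativeClass.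

End Configurations.

Theorem theorem2p3 (R : realType) (m n : nat) (C : configuration R m n)
    (simpleC : simple_conf C) :
  min_rank R (pattern C) = 2%N <->
  [/\ (2 <= m)%N /\ (2 <= n)%N,
      (forall (i : 'I_m) (j1 j2 : 'I_n),
         on_line (cline C j1) (point C i) ->
         on_line (cline C j2) (point C i) -> j1 = j2) /\
      (forall (j : 'I_n) (i1 i2 : 'I_m),
         on_line (cline C j) (point C i1) ->
         on_line (cline C j) (point C i2) -> i1 = i2)
    & exists C1 : configuration R m n,
        [/\ simple_conf C1, conf_equiv C C1
          & forall j1 j2 : 'I_n, parallel (cline C1 j1) (cline C1 j2)]].
Proof.
have [B qualB rankB] := min_rank_attained R (pattern C).
split=> [rank2|[[m_gt1 _] _ [C1 [_ eqC parC1]]]].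
  rewrite rank2 in rankB; have rank_le2 : (\rank B <= 2)%N by rewrite rankB.
  split.
  - by split; rewrite -rankB ?rank_leq_row ?rank_leq_col.
  - exact: rank_le2_on_line_inj simpleC qualB rank_le2.
  - have [s [t eqC]] := rank_le2_equiv_horizontal_conf simpleC qualB rank_le2.
    exists (horizontal_conf s t); split=> //.
    exact: simple_conf_equiv eqC simpleC.
apply/eqP; rewrite eqn_leq; apply/andP; split.
- have [s [t patternC1]] := parallel_pattern parC1.
  rewrite (min_rank_equiv R eqC) patternC1.
  exact: leq_trans (min_rank_leq (erefl _)) (rank_diff_mx s t).
- have [rowsB _] := qual_class_pairwise_free simpleC qualB.
  by rewrite -rankB pairwise_free_rows_rank_gt1.
Qed.
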